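(* Let $\mathcal S$, $\mathcal D$, $\mathcal D^\infty$ and a set of zero steps $\to_0$ be as in the context, with generated rewriting relation $\to$. For all $s,t\in\mathcal D^\infty$: $s\twoheadrightarrow^\infty t$ (there is a strongly converging rewriting sequence of some ordinal length from $s$ to $t$) if and only if there is a countable ordinal $\gamma<\omega_1$ such that $s\twoheadrightarrow_\gamma t$. In other words, $\twoheadrightarrow^\infty=\bigcup_{\gamma<\omega_1}\twoheadrightarrow_\gamma$.
   Context: Fix a set $\mathcal S$ of statements. A derivation rule $r$ consists of an arity $k=\mathrm{ar}(r)\in\mathbb N$, a partial function $r:\mathcal S^k\rightharpoonup\mathcal S$ (mapping premisses to conclusion) and a map $c_r:\{1,\dots,k\}\to\{0,1\}$; premiss $i$ is coinductive if $c_r(i)=1$, inductive otherwise. Fix a family $\mathcal D$ of derivation rules. $\mathcal D^\infty$ is the set of possibly infinite derivation trees built from rules of $\mathcal D$ (each node is a rule $r$ applied to subtrees whose conclusions are in the domain of $r$, its conclusion being the image) such that every infinite branch passes through infinitely many coinductive premisses. Write $r(s_1,\dots,s_k)$ for the tree with last rule $r$ and immediate subtrees $s_1,\dots,s_k$. Truncation: if $s$ has conclusion $S$, $s|_0$ is the one-node tree made of a fresh nullary rule with conclusion $S$, and $r(s_1,\dots,s_k)|_{d+1}=r(s_1|_{d+1-c_r(1)},\dots,s_k|_{d+1-c_r(k)})$. Metric: $\mathrm{dist}(s,t)=\inf\{2^{-d}: s|_d=t|_d\}$. Given a set $\to_0\subseteq\mathcal D^\infty\times\mathcal D^\infty$ of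 zero steps, the rewriting relation $\to$ with depth annotations is defined inductively: if $s\to_0 t$ then $s\to^{0}t$; if $s_i\to^{d}s_i'$ with $1\le i\le \mathrm{ar}(r)$ then $r(s_1,\dots,s_i,\dots,s_k)\to^{d+c_r(i)}r(s_1,\dots,s_i',\dots,s_k)$. $\to^*$ is its reflexive transitive closure. A rewriting sequence of ordinal length $\gamma$ is a family of trees $(s_\delta)_{\delta\le\gamma}$ with steps $s_\delta\to^{d_\delta}s_{\delta+1}$ for $\delta<\gamma$; it is strongly converging if for every limit ordinal $\lambda\le\gamma$, $s_\delta\to s_\lambda$ in the metric and $d_\delta\to\infty$ as $\delta\to\lambda$. $s\twoheadrightarrow^\infty t$ means there is a strongly converging sequence of some ordinal length from $s$ to $t$. Coinductive relations: for every ordinal $\gamma$ (by well-founded induction on $\gamma$), relations $\twoheadrightarrow_\gamma$ and $\overline{\twoheadrightarrow}_\gamma$ on $\mathcal D^\infty$ are defined by the following rules. (split) $s\twoheadrightarrow_\gamma t$ if there are $m\in\mathbb N$ and $s'$ with $s\rightsquigarrow^{\gamma}_{m}s'$ and $s'\overline{\twoheadrightarrow}_\gamma t$, where $s\rightsquigarrow^\gamma_m s'$ means that there are ordinals $\delta_1,\dots,\delta_m<\gamma$ and trees with $s\to^*s_1'\,\overline{\twoheadrightarrow}_{\delta_1}\,t_1\to^*s_2'\,\overline{\twoheadrightarrow}_{\delta_2}\cdots\overline{\twoheadrightarrow}_{\delta_m}\,t_m\to^*s'$ (for $m=0$ this is $s\to^* s'$). (lift$_r$) for each $r\in\mathcal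 D$ of arity $k$: $r(s_1,\dots,s_k)\,\overline{\twoheadrightarrow}_\gamma\, r(s_1',\dots,s_k')$ whenever $s_i\twoheadrightarrow_\gamma s_i'$ for all $i$, the $i$-th premiss being coinductive iff $c_r(i)=1$. Derivations built from these rules may be non-wellfounded, provided every infinite branch passes through infinitely many coinductive premisses of lift rules.
   Formalization: Zero steps are assumed to relate derivations with the same conclusion, and the lift rule is required to relate derivations with the same conclusion; without either condition the claimed equality fails. *)

(* Defs.v *)
From Stdlib Require Export Relation_Operators.
From mathcomp Require Export all_boot all_order all_algebra.
From mathcomp Require Export boolp classical_sets cardinality reals ereal.

Set Implicit Arguments.
Unset Strict Implicit.
Unset Printing Implicit Defensive.

Import Order.TTheory GRing.Theory Num.Theory.
Local Open Scope classical_set_scope.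
Local Open Scope nat_scope.

(** * Derivation rules *)

(* The partial function attached to a rule is given by its graph: [infer r y x]
   says that [y] is in the domain of [r] and that its image is [x]. *)
Record rules (S : Type) := Rules {
  rule : Type;
  arity : rule -> nat;
  infer : forall r : rule, ('I_(arity r) -> S) -> S -> Prop;
  infer_functional : forall (r : rule) (y : 'I_(arity r) -> S) (x x' : S),
    infer y x -> infer y x' -> x = x';
  coind : forall r : rule, 'I_(arity r) -> bool }.

Arguments arity {S D} r : rename.
Arguments infer {S D} r y x : rename.
Arguments coind {S D} r i : rename.

(** * Possibly infinite derivations *)

(* A position is the sequence of premiss numbers (from 0) leading to it from
   the root. A derivation is the function mapping each of its positions to the
   rule applied there together with the conclusion of that application, and
   every other sequence to [None]. The conclusions have to be recorded: they
   are not determined by the rules when a branch is infinite. With this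
   encoding, equality of derivations is Leibniz equality. *)
Section Derivations.
Context {S : Type} (D : rules S).

Definition raw_tree := seq nat -> option (rule D * S).

Definition concl (t : raw_tree) : option S := omap snd (t [::]).

Definition coindn (r : rule D) (i : nat) : bool :=
  if insub i is Some j then coind r j else false.

Definition coind_premiss (t : raw_tree) (p : seq nat) (i : nat) : bool :=
  if t p is Some (r, _) then coindn r i else false.

Record derivation := Derivation {
  label :> raw_tree;
  label_root : isSome (label [::]);
  label_domain : forall p i, isSome (label (rcons p i)) ->
    exists r x, label p = Some (r, x) /\ i < arity r;
  label_sound : forall p r x, label p = Some (r, x) ->
    exists2 y : 'I_(arity r) -> S, infer r y x &
      forall i : 'I_(arity r), omap snd (label (rcons p i)) = Some (y i);
  label_guarded : forall b : nat -> nat,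
    (forall n, isSome (label (mkseq b n))) ->
    forall n, exists2 m, n <= m & coind_premiss label (mkseq b m) (b m) }.

(* [node r ss t] is the equation [t = r(ss)]; [r(ss)] is defined only if the
   conclusions of the [ss] are in the domain of [r]. *)
Definition node (r : rule D) (ss : 'I_(arity r) -> derivation)
    (t : derivation) : Prop :=
  (exists x, label t [::] = Some (r, x)) /\
  forall (i : 'I_(arity r)) (q : seq nat), label t (val i :: q) = label (ss i) q.

Lemma derivation_eq (s t : derivation) : label s = label t -> s = t.
Proof.
case: s t => [s s1 s2 s3 s4] [t t1 t2 t3 t4] /= st.
by case: t / st t1 t2 t3 t4 => *; congr Derivation; exact: Prop_irrelevance.
Qed.

Lemma label_out (t : derivation) r x i q :
  label t [::] = Some (r, x) -> arity r <= i -> label t (i :: q) = None.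
Proof.
move=> tr ri; elim/last_ind: q => [|q j IH].
  case E: (label t [:: i]) => [l|//].
  have [|r' [x' []]] := @label_domain t [::] i; first by rewrite /= E.
  by rewrite tr => -[<- _]; rewrite ltnNge ri.
case E: (label t (i :: rcons q j)) => [l|//].
have [|r' [x' []]] := @label_domain t (i :: q) j; first by rewrite /= E.
by rewrite IH.
Qed.

Lemma node_functional r ss (t t' : derivation) :
  @node r ss t -> node ss t' -> t = t'.
Proof.
move=> [[x tx] ts] [[x' tx'] ts']; apply: derivation_eq; apply: funext.
have xx' : x = x'.
  have [y yx yi] := label_sound tx; have [y' yx' yi'] := label_sound tx'.
  suff yy' : y = y' by subst y'; exact: infer_functional yx yx'.
  apply: funext => i; apply: Some_inj.
  by rewrite -yi -yi' /= ts ts'.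
case=> [|i q]; first by rewrite tx tx' xx'.
have [ir|ri] := ltnP i (arity r); last by rewrite (label_out _ tx) ?(label_out _ tx').
by rewrite -[i]/(val (Ordinal ir)) ts ts'.
Qed.

(* In a truncated tree, the label [(None, x)] is the fresh nullary rule with
   conclusion [x]. *)
Fixpoint trunc (d : nat) (t : raw_tree) (p : seq nat) {struct p} :
    option (option (rule D) * S) :=
  match d, p with
  | 0, [::] => omap (fun l => (None, l.2)) (t [::])
  | 0, _ :: _ => None
  | d'.+1, [::] => omap (fun l => (Some l.1, l.2)) (t [::])
  | d'.+1, i :: q =>
      trunc (d'.+1 - coind_premiss t [::] i) (fun q' => t (i :: q')) q
  end.

(* Extended-real valued: derivations with distinct conclusions already differ
   at truncation depth 0, and are at distance [+oo]. *)
Definition dist (R : realType) (s t : derivation) : \bar R :=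
  ereal_inf [set ((2%:R ^- d)%R%:E : \bar R) | d in
               [set d : nat | trunc d s = trunc d t]].

(** * Rewriting *)

(* To be assumed of zero steps: a rewriting step can only be performed below a
   rule [r] if the new conclusions are still in the domain of [r]. If [r] is
   binary and only defined at [(x, x)] and [(y, y)], and if there are nullary
   rules [a] and [b] with conclusions [x] and [y] and a zero step from [a] to
   [b], then no step leaves [r(a, a)], whereas rewriting both premisses
   simultaneously leads to [r(b, b)]. *)
Definition preserves_concl (rel : derivation -> derivation -> Prop) : Prop :=
  forall s t, rel s t -> concl s = concl t.

Inductive step (zero : derivation -> derivation -> Prop) :
    nat -> derivation -> derivation -> Prop :=
| step_zero s t : zero s t -> step zero 0 s t
| step_premiss (r : rule D) (i : 'I_(arity r))
    (ss ts : 'I_(arity r) -> derivation) (s t : derivation) (d : nat) :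
    node ss s -> node ts t ->
    step zero d (ss i) (ts i) -> (forall j, j != i -> ts j = ss j) ->
    step zero (d + coind r i) s t.

Definition steps (zero : derivation -> derivation -> Prop) :
    derivation -> derivation -> Prop :=
  clos_refl_trans derivation (fun s t => exists d, step zero d s t).

End Derivations.

(** * Ordinals *)

Record wellorder := Wellorder {
  wcarrier :> Type;
  wlt : wcarrier -> wcarrier -> Prop;
  wlt_wf : well_founded wlt;
  wlt_trans : forall x y z, wlt x y -> wlt y z -> wlt x z;
  wlt_total : forall x y, [\/ wlt x y, x = y | wlt y x] }.

Arguments wlt {w} x y.

(* An ordinal is given as a point of a well-order, and stands for the order
   type of the set of points below it; the smaller ordinals are then the points
   below it, and every ordinal arises in this way. *)
Section Ordinals.
Context {W : wellorder}.
Implicit Types x y : W.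

Definition wle x y : Prop := wlt x y \/ x = y.

Definition wzero x : Prop := forall y, ~ wlt y x.

Definition wsucc x y : Prop := wlt x y /\ forall z, ~ (wlt x z /\ wlt z y).

Definition wlimit x : Prop := ~ wzero x /\ forall y, ~ wsucc y x.

Definition wcountable x : Prop := countable [set y : W | wlt y x].

End Ordinals.

(** * Infinitary rewriting by strongly converging sequences *)

Section Sequences.
Context (R : realType) {S : Type} {D : rules S}.
Variable zero : derivation D -> derivation D -> Prop.

(* A rewriting sequence of length [g] is the restriction of [u] to the ordinals
   up to [g], and of [d] to those below [g]; other values are irrelevant. *)
Definition rewriting_sequence (W : wellorder) (g : W)
    (u : W -> derivation D) (d : W -> nat) : Prop :=
  forall x y : W, wlt x g -> wsucc x y -> step zero (d x) (u x) (u y).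

Definition strongly_converging (W : wellorder) (g : W)
    (u : W -> derivation D) (d : W -> nat) : Prop :=
  forall l : W, wlimit l -> wle l g ->
    (forall e : R, (0 < e)%R -> exists2 a : W, wlt a l &
       forall x : W, wle a x -> wlt x l -> (dist R (u x) (u l) < e%:E)%E) /\
    (forall n : nat, exists2 a : W, wlt a l &
       forall x : W, wle a x -> wlt x l -> n <= d x).

Definition infinitary (s t : derivation D) : Prop :=
  exists (W : wellorder) (g : W) (u : W -> derivation D) (d : W -> nat),
    [/\ forall x : W, wzero x -> u x = s,
        u g = t,
        rewriting_sequence g u d
      & strongly_converging g u d].

End Sequences.

(** * Coinductive infinitary rewriting *)

Section Coinductive.
Context {S : Type} {D : rules S}.
Variable zero : derivation D -> derivation D -> Prop.

(* [Red s t] and [Lifted s t] stand for the plain and overlined arrows. *)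
Variant judgement :=
  | Red of derivation D & derivation D
  | Lifted of derivation D & derivation D.

(* [lower] is the union of the overlined arrows at smaller ordinals. *)
Inductive presplit (lower : derivation D -> derivation D -> Prop) :
    nat -> derivation D -> derivation D -> Prop :=
| presplit0 s s' : steps zero s s' -> presplit lower 0 s s'
| presplitS m s s1 t1 s' :
    steps zero s s1 -> lower s1 t1 -> presplit lower m t1 s' ->
    presplit lower m.+1 s s'.

(* The relations at a given ordinal are defined by a system of derivation rules
   whose statements are judgements, so that the condition on the infinite
   branches of the derivations of judgements is the one of [derivation]. *)
Section Level.
Variable lower : derivation D -> derivation D -> Prop.

Variant red_rule :=
  | Split (s s' : derivation D) of (exists m, presplit lower m s s')
  | Lift of rule D.

Definition red_arity (a : red_rule) : nat :=
  match a with Split _ _ _ => 1 | Lift r => arity r end.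

(* A judgement only relates derivations of the same statement, which is what
   [concl s = concl t] says in the [Lift] case; for [Split] it follows. Without
   it, if [r] is a unary coinductive rule that is the identity on [S], then
   [Lift r] alone would derive [Lifted s t] for the infinite derivations
   [s = r(s)] of [x] and [t = r(t)] of [y], for distinct [x] and [y], even if
   there is no zero step at all. *)
Definition red_infer (a : red_rule) :
    ('I_(red_arity a) -> judgement) -> judgement -> Prop :=
  match a return ('I_(red_arity a) -> judgement) -> judgement -> Prop with
  | Split s s' _ => fun y j =>
      exists t, y ord0 = Lifted s' t /\ j = Red s t
  | Lift r => fun y j =>
      exists (ss ts : 'I_(arity r) -> derivation D) (s t : derivation D),
        [/\ forall i, y i = Red (ss i) (ts i), node ss s, node ts t,
            concl s = concl t & j = Lifted s t]
  end.

Definition red_coind (a : red_rule) : 'I_(red_arity a) -> bool :=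
  match a return 'I_(red_arity a) -> bool with
  | Split _ _ _ => fun=> false
  | Lift r => coind r
  end.

Lemma red_infer_functional (a : red_rule) (y : 'I_(red_arity a) -> judgement)
    (j j' : judgement) :
  red_infer y j -> red_infer y j' -> j = j'.
Proof.
case: a y => [s s' ss'|r] y /=.
  by move=> [t [yt ->]] [t' [yt' ->]]; move: yt'; rewrite yt => -[->].
move=> [ss [ts [s [t [yst sn tn _ ->]]]]] [ss' [ts' [s' [t' [yst' sn' tn' _ ->]]]]].
have E i : ss i = ss' i /\ ts i = ts' i.
  by move: (yst' i); rewrite yst => -[].
have Es : ss = ss' by apply: funext => i; case: (E i).
have Et : ts = ts' by apply: funext => i; case: (E i).
by subst ss' ts'; rewrite (node_functional sn sn') (node_functional tn tn').
Qed.

Definition red_rules : rules judgement :=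
  {| rule := red_rule;
     arity := red_arity;
     infer := red_infer;
     infer_functional := red_infer_functional;
     coind := red_coind |}.

End Level.

Definition holds (W : wellorder) : W -> judgement -> Prop :=
  Fix (@wlt_wf W) (fun _ => judgement -> Prop)
    (fun g rec j =>
       exists T : derivation (red_rules (fun s t =>
                    exists (x : W) (xg : wlt x g), rec x xg (Lifted s t))),
         concl T = Some j).

Definition coinductive_red (W : wellorder) (g : W) (s t : derivation D) : Prop :=
  holds g (Red s t).

End Coinductive.

(* Main.v *)
(* Both directions pass through sequences that may stutter, i.e. take trivial
   steps: this makes them closed under projection to an immediate subderivation
   and under concatenation.

   From left to right, by induction on the length [y]: a sequence ending at [y]
   splits into a shorter one, handled by the induction hypothesis, and a rest
   all of whose steps have positive depth, which is projected to the immediate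
   subderivations and treated coinductively at the same level [y]. The length is
   countable because the depths tend to infinity at limits, so that all limits
   have cofinality omega.

   From right to left, by induction on the level: unfolding a coinductive
   derivation down to depth [n], for all [n], yields successive sequences of
   steps at depth at least [n], whose concatenation converges. *)
From Stdlib Require Import Wellfounded.
Require Import Defs.

Set Implicit Arguments.
Unset Strict Implicit.
Unset Printing Implicit Defensive.

Import Order.TTheory GRing.Theory Num.Theory.
Local Open Scope classical_set_scope.
Local Open Scope nat_scope.

(** * Derivations *)

Section DerivationTheory.
Context {S : Type} {D : rules S}.
Implicit Types (s t : derivation D) (r : rule D).

Lemma coindnE r (i : 'I_(arity r)) : coindn r i = coind r i.
Proof. by rewrite /coindn valK. Qed.

Lemma subsub_gt m n c : m < n -> c <= 1 -> m <= n - c.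
Proof. by case: c => [|[|c]] //; rewrite ?subn0 ?subn1; [move/ltnW|case: n]. Qed.

Lemma rootP t : exists r x, label t [::] = Some (r, x).
Proof. by case E : (label t [::]) (label_root t) => [[r x]|//] _; exists r, x. Qed.

Section Subtree.
Variables (t : derivation D) (i : nat) (ti : isSome (label t [:: i])).

Let sub_label : raw_tree D := fun q => label t (i :: q).

Lemma subtree_domain p j : isSome (sub_label (rcons p j)) ->
  exists r x, sub_label p = Some (r, x) /\ j < arity r.
Proof. exact: (@label_domain _ _ t (i :: p)). Qed.

Lemma subtree_sound p r x : sub_label p = Some (r, x) ->
  exists2 y : 'I_(arity r) -> S, infer r y x &
    forall j : 'I_(arity r), omap snd (sub_label (rcons p j)) = Some (y j).
Proof. exact: (@label_sound _ _ t (i :: p)). Qed.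

Lemma subtree_guarded (b : nat -> nat) :
  (forall n, isSome (sub_label (mkseq b n))) ->
  forall n, exists2 m, n <= m & coind_premiss sub_label (mkseq b m) (b m).
Proof.
(* The branch is prefixed by [i] to become a branch of [t]; asking for an index of at least [n.+1]
   excludes the edge into the subtree. *)
move=> bP n; pose b' k := if k is k'.+1 then b k' else i.
have b'E k : mkseq b' k.+1 = i :: mkseq b k.
  by rewrite /mkseq /= (iotaDl 1 0) -map_comp.
have [[|k]|[//|m] nm mP] := @label_guarded _ _ t b' _ n.+1.
- exact: label_root.
- by rewrite b'E; exact: bP.
by exists m => //; move: mP; rewrite b'E.
Qed.

Definition subtree : derivation D :=
  @Derivation S D sub_label ti subtree_domain subtree_sound subtree_guarded.

End Subtree.

(** Made total by the dummy value [t] at a missing premiss. *)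
Definition child t i : derivation D :=
  if pselect (isSome (label t [:: i])) is left ti then subtree ti else t.

Lemma root_child t r x (i : 'I_(arity r)) :
  label t [::] = Some (r, x) -> isSome (label t [:: val i]).
Proof.
by move=> tr; have [y _ yi] := label_sound tr; have /= := yi i; case: (label t _).
Qed.

Lemma node_child t r x :
  label t [::] = Some (r, x) -> node (fun i : 'I_(arity r) => child t i) t.
Proof.
move=> tr; split; first by exists x.
by move=> i q; rewrite /child; case: pselect => // -[]; exact: root_child tr.
Qed.

Lemma node_ex t : exists r (ss : 'I_(arity r) -> derivation D), node ss t.
Proof.
by have [r [x tr]] := rootP t; exists r; eexists; exact: node_child tr.
Qed.

Lemma node_inj r (ss ss' : 'I_(arity r) -> derivation D) t :
  node ss t -> node ss' t -> ss = ss'.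
Proof.
move=> [_ st] [_ st']; apply: funext => i; apply: derivation_eq.
by apply: funext => q; rewrite -st -st'.
Qed.

Lemma node_concl_sub r (ss : 'I_(arity r) -> derivation D) t x :
  node ss t -> label t [::] = Some (r, x) ->
  exists2 y, infer r y x & forall i, concl (ss i) = Some (y i).
Proof.
move=> [_ st] tr; have [y yx yi] := label_sound tr; exists y => // i.
by rewrite -yi /= /concl -st.
Qed.

(** Rules are partial functions, so the conclusion at the root cannot change while the rule and the
    conclusions of its premisses stay the same. *)
Lemma node_concl r (ss ss' : 'I_(arity r) -> derivation D) s s' :
  node ss s -> node ss' s' -> (forall i, concl (ss i) = concl (ss' i)) ->
  label s [::] = label s' [::].
Proof.
move=> ns ns' E; have [[x sx] _] := ns; have [[x' sx'] _] := ns'.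
have [y yx yi] := node_concl_sub ns sx.
have [y' yx' yi'] := node_concl_sub ns' sx'.
have yy' : y = y' by apply: funext => i; apply: Some_inj; rewrite -yi -yi' E.
by subst y'; rewrite sx sx' (infer_functional yx yx').
Qed.

Section Build.
Variables (r : rule D) (x : S) (y : 'I_(arity r) -> S) (yx : infer r y x).
Variables (ss : 'I_(arity r) -> derivation D).
Hypothesis ssy : forall i, concl (ss i) = Some (y i).

Let lab : raw_tree D := fun p =>
  if p is i :: q then (if insub i is Some j then label (ss j) q else None)
  else Some (r, x).

Let labE (i : 'I_(arity r)) q : lab (val i :: q) = label (ss i) q.
Proof. by rewrite /lab valK. Qed.

Let lab_domain p j : isSome (lab (rcons p j)) ->
  exists r x, lab p = Some (r, x) /\ j < arity r.
Proof.
case: p => [|i p]; rewrite /lab /=; case: insubP => // k kr kE.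
  by move=> _; exists r, x.
exact: label_domain.
Qed.

Let lab_sound p r' x' : lab p = Some (r', x') ->
  exists2 y : 'I_(arity r') -> S, infer r' y x' &
    forall j : 'I_(arity r'), omap snd (lab (rcons p j)) = Some (y j).
Proof.
case: p => [|i p] /=.
  case=> er ex; subst r' x'; exists y => // j.
  by have := labE j [::]; rewrite /lab /= => ->; exact: ssy.
by case: insubP => // k _ _; exact: label_sound.
Qed.

Let lab_guarded (b : nat -> nat) :
  (forall n, isSome (lab (mkseq b n))) ->
  forall n, exists2 m, n <= m & coind_premiss lab (mkseq b m) (b m).
Proof.
move=> bP n; pose b' k := b k.+1.
have bE k : mkseq b k.+1 = b 0 :: mkseq b' k.
  by rewrite /mkseq /= (iotaDl 1 0) -map_comp.
have := bP 1; rewrite bE /lab; case E : insub => [j|//] _.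
have [k|m nm mP] := @label_guarded _ _ (ss j) b' _ n.
  by have := bP k.+1; rewrite bE /lab E.
exists m.+1; first exact: leqW.
by rewrite bE /coind_premiss /lab E.
Qed.

Lemma node_build : exists t, node ss t /\ label t [::] = Some (r, x).
Proof.
exists (@Derivation S D lab isT lab_domain lab_sound lab_guarded).
by split=> //; split; [exists x | exact: labE].
Qed.

End Build.

(** Equal conclusions keep the premisses in the domain of [r]. This is what allows rewriting that
    preserves conclusions to take place below a rule. *)
Lemma node_replace r (ss ss' : 'I_(arity r) -> derivation D) s :
  node ss s -> (forall i, concl (ss' i) = concl (ss i)) ->
  exists2 s', node ss' s' & concl s' = concl s.
Proof.
move=> ns E; have [[x sx] _] := ns.
have [y yx yi] := node_concl_sub ns sx.
have [|s' [ns' s'x]] := node_build yx (ss := ss'); first by move=> i; rewrite E.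
by exists s' => //; rewrite /concl sx s'x.
Qed.

(* A counterexample would yield an infinite branch through inductive premisses
   only. *)
Lemma derivation_guarded_ind (P : derivation D -> Prop) :
  (forall r (ss : 'I_(arity r) -> derivation D) t, node ss t ->
     (forall i, ~~ coind r i -> P (ss i)) -> P t) ->
  forall t, P t.
Proof.
move=> IH t0; apply: contrapT => nP0.
have /choice[f fP] t : exists i, ~ P t ->
    [/\ isSome (label t [:: i]), ~~ coind_premiss t [::] i & ~ P (child t i)].
  have [r [x tr]] := rootP t; apply: contrapT => /forallNP H.
  have nPt : ~ P t by move=> Pt; apply: (H 0).
  apply: nPt; apply: (IH _ _ _ (node_child tr)) => i ni.
  apply: contrapT => nPi; apply: (H i) => _; split=> //.
    exact: root_child tr.
  by rewrite /coind_premiss tr coindnE.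
(* [T n] is the subderivation at the end of the first [n] edges of the branch [b], which always
   moves to a counterexample. *)
pose T n := iter n (fun t => child t (f t)) t0; pose b n := f (T n).
have nPT n : ~ P (T n) by elim: n => //= n /fP[].
have TE n q : label (T n) q = label t0 (mkseq b n ++ q).
  elim: n q => // n IHn q; rewrite [mkseq b n.+1]mkseqS cat_rcons -IHn /=.
  by rewrite /child; case: pselect => //; have [] := fP _ (nPT n).
have [n|m _] := @label_guarded _ _ t0 b _ 0.
  by rewrite -[mkseq b n]cats0 -TE; exact: label_root.
have [_ + _] := fP _ (nPT m).
by rewrite /coind_premiss TE cats0 => /negP.
Qed.

End DerivationTheory.

(** * Truncation *)

Section Truncation.
Context {S : Type} {D : rules S}.
Implicit Types (s t : derivation D) (r : rule D).

Lemma trunc_concl s t d : trunc d s = trunc d t -> concl s = concl t.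
Proof.
move=> /(congr1 (@^~ [::])); rewrite /concl.
by case: d => [|d] /=; case: (label s [::]) => [[r x]|];
  case: (label t [::]) => [[r' x']|] //= [] *; congruence.
Qed.

Lemma trunc0_concl s t : concl s = concl t -> trunc 0 s = trunc 0 t.
Proof.
rewrite /concl => E; apply: funext => -[|//] /=.
by move: E; case: (label s [::]) => [[r x]|];
  case: (label t [::]) => [[r' x']|] //= -[->].
Qed.

Lemma trunc_root s t d : trunc d.+1 s = trunc d.+1 t ->
  label s [::] = label t [::].
Proof.
move=> /(congr1 (@^~ [::])) /=; case: (label s [::]) => [[r x]|];
  by case: (label t [::]) => [[r' x']|] //= [-> ->].
Qed.

Lemma node_truncS r (ss : 'I_(arity r) -> derivation D) s (i : 'I_(arity r))
    q d : node ss s ->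
  trunc d.+1 s (val i :: q) = trunc (d.+1 - coind r i) (ss i) q.
Proof.
move=> [[x sx] si] /=; rewrite {1}/coind_premiss sx coindnE.
by congr trunc; apply: funext => q'; rewrite si.
Qed.

Lemma node_trunc r (ss ts : 'I_(arity r) -> derivation D) s t d :
  node ss s -> node ts t -> concl s = concl t ->
  (forall i, trunc (d.+1 - coind r i) (ss i) = trunc (d.+1 - coind r i) (ts i)) ->
  trunc d.+1 s = trunc d.+1 t.
Proof.
move=> ns nt st E; have [[x sx] _] := ns; have [[x' tx'] _] := nt.
have xx' : x = x' by move: st; rewrite /concl sx tx' => -[].
apply: funext => -[|i q] /=; first by rewrite sx tx' xx'.
have [ir|ri] := ltnP i (arity r).
  by have := node_truncS (Ordinal ir) q d ns;
     have := node_truncS (Ordinal ir) q d nt;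
     rewrite /= => -> ->; rewrite E.
(* Beyond the arity both trees are undefined, and truncation preserves this. *)
have none (f : raw_tree D) d' : (forall q, f q = None) -> trunc d' f q = None.
  elim: q f d' => [|j q IH] f [|d'] f0 //=; rewrite ?f0 //.
  by apply: IH => q'; rewrite f0.
by rewrite !none // => q'; [exact: label_out _ tx' ri | exact: label_out _ sx ri].
Qed.

Lemma trunc_node r (ss ts : 'I_(arity r) -> derivation D) s t d i :
  node ss s -> node ts t -> trunc d.+1 s = trunc d.+1 t ->
  trunc (d.+1 - coind r i) (ss i) = trunc (d.+1 - coind r i) (ts i).
Proof.
move=> ns nt E; apply: funext => q.
by rewrite -(node_truncS i q d ns) -(node_truncS i q d nt) E.
Qed.

Lemma trunc_le s t d d' : d' <= d -> trunc d s = trunc d t ->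
  trunc d' s = trunc d' t.
Proof.
move=> dd' st; apply: funext => p.
elim: p d d' s t dd' st => [|i p IH] [|d] [|d'] s t //= dd' st.
- by have /trunc0_concl/(congr1 (@^~ [::])) := trunc_concl st.
- by have /trunc0_concl/(congr1 (@^~ [::])) := trunc_concl st.
- by rewrite (trunc_root st).
have root := trunc_root st; have [r [x sr]] := rootP s.
have ns := node_child sr; have := node_child (etrans (esym root) sr) => nt.
have [ir|ri] := ltnP i (arity r).
  have := node_truncS (Ordinal ir) p d' ns; have := node_truncS (Ordinal ir) p d' nt.
  move=> /= -> ->; apply: IH (leq_sub2r _ dd') _.
  exact: trunc_node (Ordinal ir) ns nt st.
have E : (fun q => label s (i :: q)) = (fun q => label t (i :: q)).
  apply: funext => q.
  by rewrite (label_out q sr ri) (label_out q (etrans (esym root) sr) ri).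
by rewrite /coind_premiss root E.
Qed.

(** Each edge uses up at most one unit of truncation depth, so the cut is never reached at positions
    shorter than [d]. *)
Lemma trunc_label (f : raw_tree D) d p : size p < d ->
  trunc d f p = omap (fun l => (Some l.1, l.2)) (f p).
Proof.
elim: p f d => [|i p IH] f [|d] //= pd; apply: IH.
by apply: subsub_gt => //; case: coind_premiss.
Qed.

Lemma trunc_eq s t : (forall d, trunc d s = trunc d t) -> s = t.
Proof.
move=> E; apply: derivation_eq; apply: funext => p.
have := congr1 (@^~ p) (E (size p).+1); rewrite !trunc_label //.
by case: (label s p) => [[r x]|]; case: (label t p) => [[r' x']|] //= [-> ->].
Qed.

End Truncation.

(** * Well-orders *)

Section WellorderTheory.
Context {W : wellorder}.
Implicit Types x y z l : W.

Lemma wlt_irr x : ~ wlt x x.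
Proof. by elim: x / (wlt_wf x) => x _ IH xx; exact: (IH x). Qed.

Lemma wle_refl x : wle x x. Proof. by right. Qed.

Lemma wltW x y : wlt x y -> wle x y. Proof. by left. Qed.

Lemma wlt_le_trans x y z : wlt x y -> wle y z -> wlt x z.
Proof. by move=> xy [|<-] //; exact: wlt_trans. Qed.

Lemma wle_lt_trans x y z : wle x y -> wlt y z -> wlt x z.
Proof. by move=> [|->] //; exact: wlt_trans. Qed.

Lemma wle_trans x y z : wle x y -> wle y z -> wle x z.
Proof. by move=> xy [yz|<-] //; left; exact: wle_lt_trans yz. Qed.

Lemma wleNgt x y : wle x y -> ~ wlt y x.
Proof. by move=> xy /(wle_lt_trans xy)/wlt_irr. Qed.

Lemma wltgeP x y : wlt x y \/ wle y x.
Proof. by have [|->|] := wlt_total x y; [left|right; right|right; left]. Qed.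

Lemma wle_anti x y : wle x y -> wle y x -> x = y.
Proof. by move=> [xy|//] /wleNgt. Qed.

Lemma wmin (P : W -> Prop) : (exists x, P x) ->
  exists2 x, P x & forall y, P y -> wle x y.
Proof.
move=> [x]; elim: x / (wlt_wf x) => x _ IH Px.
have [[y yx Py]|noy] := pselect (exists2 y, wlt y x & P y); first exact: IH Py.
exists x => // y Py; have [yx|//] := wltgeP y x.
by case: noy; exists y.
Qed.

Lemma wsucc_le x x' y : wsucc x x' -> wlt x y -> wle x' y.
Proof. by move=> [_ H] xy; have [yx'|//] := wltgeP y x'; case: (H y). Qed.

Lemma wlt_succ x x' y : wsucc x x' -> wlt y x' -> wle y x.
Proof. by move=> [_ H] yx'; have [xy|//] := wltgeP x y; case: (H y). Qed.

Lemma wsucc_limit x x' l : wlimit l -> wsucc x x' -> wlt x l -> wlt x' l.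
Proof.
by move=> [_ nl] xx' /(wsucc_le xx')[//|x'l]; case: (nl x); rewrite -x'l.
Qed.

Lemma wcases x : [\/ wzero x, exists z, wsucc z x | wlimit x].
Proof.
have [x0|x0] := pselect (wzero x); first by constructor 1.
have [[z zx]|nx] := pselect (exists z, wsucc z x); first by constructor 2; exists z.
by constructor 3; split=> // y yx; apply: nx; exists y.
Qed.

Lemma wzero_le x y : wzero x -> wle x y.
Proof. by move=> x0; have [/x0|] := wltgeP y x. Qed.

Lemma wzero_ex (x : W) : exists z : W, wzero z.
Proof.
have [|z _ zmin] := @wmin (fun=> True); first by exists x.
by exists z => y yz; exact: wleNgt (zmin y I) yz.
Qed.

Lemma wmax2 x y z : wlt x z -> wlt y z ->
  exists m, [/\ wlt m z, wle x m & wle y m].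
Proof.
move=> xz yz; have [xy|yx] := wltgeP x y.
  by exists y; split=> //; [left|right].
by exists x; split=> //; right.
Qed.

End WellorderTheory.

(** * Strongly converging sequences with stuttering *)

Section Stuttering.
Context {S : Type} {D : rules S}.
Variable zero : derivation D -> derivation D -> Prop.
Hypothesis zero_concl : preserves_concl zero.
Implicit Types s t : derivation D.

(** A zero step preserves the conclusion, which is all that depth 0 shows. A coinductive premiss
    adds one both to the depth of the step and to the depth of truncation. *)
Lemma step_trunc k s t : step zero k s t -> trunc k s = trunc k t.
Proof.
elim=> {k s t} [s t /zero_concl/trunc0_concl //|r i ss ts s t d ns nt _ IH E].
have ssts j : concl (ss j) = concl (ts j).
  by have [->|/E->//] := eqVneq j i; exact: trunc_concl IH.
have st : concl s = concl t by rewrite /concl (node_concl ns nt).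
case dc : (d + _) => [|k]; first exact: trunc0_concl.
apply: node_trunc ns nt st _ => j; have [->|/E->//] := eqVneq j i.
by rewrite -dc addnK.
Qed.

(** A trivial step counts as infinitely deep: it is allowed for every [n]. *)
Definition stepge n s t := s = t \/ exists2 k, n <= k & step zero k s t.

Lemma stepge_le m n s t : m <= n -> stepge n s t -> stepge m s t.
Proof.
by move=> mn [->|[k nk st]]; [left|right; exists k => //; exact: leq_trans nk].
Qed.

Lemma stepge_trunc n s t : stepge n s t -> trunc n s = trunc n t.
Proof. by move=> [->//|[k nk /step_trunc]]; exact: trunc_le. Qed.

Lemma stepge_steps n s t : stepge n s t -> steps zero s t.
Proof. by move=> [->|[k _ st]]; [exact: rt_refl|apply: rt_step; exists k]. Qed.

Lemma stepge_node n r (i : 'I_(arity r)) (ss ts : 'I_(arity r) -> derivation D) s t :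
  node ss s -> node ts t -> (forall j, j != i -> ts j = ss j) ->
  stepge (n - coind r i) (ss i) (ts i) -> stepge n s t.
Proof.
move=> ns nt E [ei|[k nk st]].
  left; suff sst : ss = ts by move: nt; rewrite -sst; exact: node_functional.
  by apply: funext => j; have [->|/E] := eqVneq j i.
by right; exists (k + coind r i);
  [rewrite addnC -leq_subLR|exact: step_premiss st E].
Qed.

Lemma node_stepge n r (i : 'I_(arity r)) (ss ts : 'I_(arity r) -> derivation D) s t :
  node ss s -> node ts t -> stepge n.+1 s t ->
  stepge (n.+1 - coind r i) (ss i) (ts i).
Proof.
move=> ns nt [st|[k nk st]].
  by left; move: nt; rewrite -st => nt; rewrite (node_inj ns nt).
case: st nk ns nt => // r' i' ss' ts' s' t' d ns' nt' st E nk ns nt.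
have er : r' = r 
  by case: ns ns' => [[x E1] _] [[x']]; rewrite E1 => -[-> _] _.
subst r'; rewrite (node_inj ns ns') (node_inj nt nt').
have [->|/E->] := eqVneq i i'; last by left.
by right; exists d => //; rewrite leq_subLR addnC.
Qed.

(** Strong convergence at [l], with the metric expressed by truncations and a single threshold for
    both the trees and the depths. *)
Definition conv (W : wellorder) (u : W -> derivation D) (l : W) :=
  forall n, exists2 a, wlt a l & forall x, wle a x -> wlt x l ->
    trunc n (u x) = trunc n (u l) /\
    forall x', wsucc x x' -> stepge n (u x) (u x').

Definition stutseq n (W : wellorder) (a b : W) (u : W -> derivation D) :=
  (forall x x', wle a x -> wlt x b -> wsucc x x' -> stepge n (u x) (u x')) /\
  (forall l, wlimit l -> wlt a l -> wle l b -> conv u l).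

Lemma stutseq_sub n (W : wellorder) (a b a' b' : W) u : wle a a' -> wle b' b ->
  stutseq n a b u -> stutseq n a' b' u.
Proof.
move=> aa' bb' [st cv]; split=> [x x' ax xb|l l1 al lb].
  by apply: st; [exact: wle_trans ax|exact: wlt_le_trans bb'].
by apply: cv => //; [exact: wle_lt_trans al|exact: wle_trans bb'].
Qed.

(** Transfinite induction on [x]: a step of depth at least [n] keeps the truncation, and a limit
    agrees to depth [n] with some earlier point past [a]. *)
Lemma stutseq_trunc n (W : wellorder) (a b x : W) u :
  stutseq n a b u -> wle a x -> wle x b ->
  trunc n (u a) = trunc n (u x).
Proof.
move=> [st cv]; elim: x / (wlt_wf x) => x _ IH [ax|->//] xb.
have [x0|[z zx]|xl] := wcases x; first by case: (x0 a).
  have az := wlt_succ zx ax; have zb := wlt_le_trans zx.1 xb.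
  by rewrite (IH z zx.1 az (wltW zb)); exact: stepge_trunc (st _ _ az zb zx).
have [c cx /(_ _ _ _)] := cv x xl ax xb n.
have [m [mx cm am] /(_ m cm mx)[<- _]] := wmax2 cx ax.
by apply: IH => //; left; exact: wlt_le_trans xb.
Qed.

(* The hypothesis holds iff all steps are trivial. *)
Lemma stutseq_const (W : wellorder) (a b : W) u :
  (forall n, stutseq n a b u) -> wle a b -> u a = u b.
Proof.
move=> H ab; apply: trunc_eq => n.
by apply: stutseq_trunc (H n) _ _ => //; right.
Qed.

End Stuttering.

(** * Coinduction *)

Section Coinduction.
Context {S : Type} {D : rules S}.

Definition inductive_premiss (x' x : S) : Prop :=
  exists (r : rule D) (y : 'I_(arity r) -> S) i,
    [/\ infer r y x, ~~ coind r i & x' = y i].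

(** Unfolding a choice of rules for the elements of [Y] gives a tree, and well-foundedness prevents
    its branches from running through inductive premisses forever. *)
Lemma coinduction (Y : S -> Prop) :
  (forall x, Y x -> exists (r : rule D) (y : 'I_(arity r) -> S),
     infer r y x /\ forall i, Y (y i)) ->
  well_founded inductive_premiss ->
  forall x, Y x -> exists T : derivation D, concl T = Some x.
Proof.
move=> YP wf x Yx; pose St := {x : S | Y x}.
have /choice[F FP] (a : St) : exists p : {r : rule D & 'I_(arity r) -> St},
    infer (tag p) (fun i => sval (tagged p i)) (sval a).
  case: a => z Yz; have [r [y [yz Yy]]] := YP z Yz.
  by exists (existT _ r (fun i => exist _ (y i) (Yy i))).
pose rl a := tag (F a); pose nx a : 'I_(arity (rl a)) -> St := tagged (F a).
pose lab := fix lab (p : seq nat) (a : St) {struct p} : option (rule D * S) :=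
  if p is i :: q then
    (if insub i is Some j then lab q (nx a j) else None)
  else Some (rl a, sval a).
have bS (b : nat -> nat) k : mkseq b k.+1 = b 0 :: mkseq (b \o succn) k.
  by rewrite /mkseq /= (iotaDl 1 0) -map_comp.
(* Well-founded induction yields one coinductive premiss on every branch; [guard] then finds one
   past any index by dropping an initial part of the branch. *)
have guard1 (a : St) (b : nat -> nat) : (forall n, isSome (lab (mkseq b n) a)) ->
    exists m, coind_premiss (lab^~ a) (mkseq b m) (b m).
  elim/(well_founded_ind (wf_inverse_image St _ _ sval wf)): a b => a IH b bP.
  have := bP 1; rewrite bS /=; case Ej : insub => [j|//] _.
  have jb : val j = b 0 by move: Ej; case: insubP => // j' _ + [<-].
  have [cj|ncj] := boolP (coind (rl a) j).
    by exists 0; rewrite /coind_premiss /= -jb coindnE.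
  have [||m mP] := IH (nx a j) _ (b \o succn).
  - by exists (rl a), (fun i => sval (nx a i)), j; split=> //; exact: FP.
  - by move=> n; have := bP n.+1; rewrite bS /= Ej.
  by exists m.+1; rewrite bS /coind_premiss /= Ej.
have guard a b : (forall n, isSome (lab (mkseq b n) a)) ->
    forall n, exists2 m, n <= m & coind_premiss (lab^~ a) (mkseq b m) (b m).
  move=> bP n; elim: n a b bP => [|n IH] a b bP.
    by have [m mP] := guard1 a b bP; exists m.
  have := bP 1; rewrite bS /=; case Ej : insub => [j|//] _.
  have [|m nm mP] := IH (nx a j) (b \o succn).
    by move=> k; have := bP k.+1; rewrite bS /= Ej.
  by exists m.+1 => //; rewrite bS /coind_premiss /= Ej.
have dom a p i : isSome (lab (rcons p i) a) ->
    exists r z, lab p a = Some (r, z) /\ i < arity r.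
  elim: p a => [|j p IH] a /=; last by case: insub => // k; exact: IH.
  by case: insubP => // j ji _ _; exists (rl a), (sval a).
have sound a p r z : lab p a = Some (r, z) ->
    exists2 y : 'I_(arity r) -> S, infer r y z &
      forall i : 'I_(arity r), omap snd (lab (rcons p i) a) = Some (y i).
  elim: p a => [|j p IH] a /=; last by case: insub => // k; exact: IH.
  case=> <- <-; exists (fun i => sval (nx a i)); first exact: FP.
  by move=> i; rewrite valK.
pose a0 : St := exist _ x Yx.
by exists (@Derivation S D (lab^~ a0) isT (dom a0) (sound a0) (guard a0)).
Qed.

End Coinduction.

(** * Unfolding the coinductive relations at a given level *)

Section RedTheory.
Context {S : Type} {D : rules S}.
Variable zero : derivation D -> derivation D -> Prop.
Implicit Types s t : derivation D.
Implicit Types lower : derivation D -> derivation D -> Prop.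

Lemma node_rule r r' (ss : 'I_(arity r) -> derivation D)
    (ss' : 'I_(arity r') -> derivation D) t : node ss t -> node ss' t -> r = r'.
Proof. by move=> [[x tx] _] [[x' tx'] _]; move: tx'; rewrite tx => -[]. Qed.

Definition derivable lower (j : judgement) :=
  exists T : derivation (red_rules zero lower), concl T = Some j.

Definition lower_at (W : wellorder) (g : W) s t :=
  exists (x : W) (xg : wlt x g), holds zero x (Lifted s t).

Lemma holdsE (W : wellorder) (g : W) j :
  holds zero g j = derivable (lower_at g) j.
Proof.
rewrite /holds Fix_eq // => x f h E; apply: funext => j'.
by suff -> : f = h by []; apply: functional_extensionality_dep => y;
  apply: functional_extensionality_dep => p; exact: E.
Qed.

(* Split does not change the right-hand side and Lift passes to its immediate
   subderivations, so that guardedness is inherited from the latter. *)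
Lemma red_rules_wf lower :
  well_founded (@inductive_premiss _ (red_rules zero lower)).
Proof.
suff H t s : Acc (@inductive_premiss _ (red_rules zero lower)) (Lifted s t)
    /\ Acc (@inductive_premiss _ (red_rules zero lower)) (Red s t).
  by case=> s t; have [] := H t s.
elim/(@derivation_guarded_ind S D): t s => r ss t nt IH.
(* [Lifted] comes first, as its inductive premisses concern subderivations of [t]; [Red] then
   reduces to [Lifted] with the same [t]. *)
have A s : Acc (@inductive_premiss _ (red_rules zero lower)) (Lifted s t).
  constructor=> j [[s1 s2 m|r'] [y [i []]]] /=; first by case=> ? [].
  move=> [ss' [ts [s' [t' [yE ns' nt' _ [es et]]]]]] ci ->; subst s' t'.
  rewrite yE; have er := node_rule nt nt'; subst r'.
  by rewrite -(node_inj nt nt'); apply: (IH i ci _).2.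
move=> s; split; first exact: A.
constructor=> j [[s1 s2 m|r'] [y [i []]]] /=.
  by move=> [t' [y0 [es et]]] _ ->; rewrite (ord1 i) y0 -et.
by move=> [ss' [ts [s' [t' []]]]].
Qed.

Lemma presplit_rcons lower m s s1 t1 t : presplit zero lower m s s1 ->
  lower s1 t1 -> steps zero t1 t -> presplit zero lower m.+1 s t.
Proof.
move=> H l st; elim: H l => {m s s1} [s s' ss' l|m s s2 t2 s' ss2 l2 _ IH l].
  by apply: presplitS ss' l _; exact: presplit0.
by apply: presplitS ss2 l2 _; exact: IH.
Qed.

Lemma presplit_sub (lower lower' : derivation D -> derivation D -> Prop) m s t :
  (forall s t, lower s t -> lower' s t) ->
  presplit zero lower m s t -> presplit zero lower' m s t.
Proof.
move=> L; elim=> {m s t} [s s' ss'|m s s2 t2 s' ss2 l2 _ IH].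
  exact: presplit0.
exact: presplitS ss2 (L _ _ l2) IH.
Qed.

Lemma derivable_child lower (T : derivation (red_rules zero lower)) r
    (TT : 'I_(arity r) -> derivation (red_rules zero lower)) j :
  node TT T -> concl T = Some j ->
  exists2 y, @infer _ (red_rules zero lower) r y j
    & forall i, concl (TT i) = Some (y i).
Proof.
move=> nT; have [[x Tx] _] := nT; rewrite /concl Tx => -[<-].
exact: node_concl_sub nT Tx.
Qed.

Lemma derivable_split lower s t : derivable lower (Red s t) ->
  exists s' m, presplit zero lower m s s' /\ derivable lower (Lifted s' t).
Proof.
move=> [T TE]; have [[s1 s2 [m H]|r] [TT nT]] := node_ex T; last first.
  by have [y [? [? [? [? []]]]]] := derivable_child nT TE.
have [y /= [t' [y0 [es et]]] yi] := derivable_child nT TE.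
exists s2, m; split; first by rewrite es.
by exists (TT ord0); rewrite yi y0 et.
Qed.

End RedTheory.

(** * From strongly converging sequences to coinductive derivations *)

Section SequenceToRed.
Context {S : Type} {D : rules S}.
Variable zero : derivation D -> derivation D -> Prop.
Hypothesis zero_concl : preserves_concl zero.
Implicit Types s t : derivation D.

(** All steps have positive depth, so the root label is constant on the interval and the [i]-th
    children form a stuttering sequence of their own. *)
Lemma stutseq_child n (W : wellorder) (a b : W) u : wle a b ->
  stutseq zero n.+1 a b u ->
  exists r, exists2 v : 'I_(arity r) -> W -> derivation D,
    node (v^~ a) (u a) /\ node (v^~ b) (u b) &
    forall i, stutseq zero (n.+1 - coind r i) a b (v i).
Proof.
move=> ab H; have [r [x ua]] := rootP (u a).
have ux z : wle a z -> wle z b -> label (u z) [::] = Some (r, x).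
  move=> az zb; rewrite -ua; symmetry.
  exact: trunc_root (stutseq_trunc zero_concl H az zb).
pose v (i : 'I_(arity r)) z := child (u z) i.
have nv z : wle a z -> wle z b -> node (v^~ z) (u z).
  by move=> az zb; exact: node_child (ux z az zb).
exists r, v; first by split; apply: nv => //; right.
have [st cv] := H; move=> i; split=> [z z' az zb zz'|l ll al lb k].
  have zb' := wsucc_le zz' zb; have az' := wle_trans az (wltW zz'.1).
  exact: (node_stepge i (nv z az (wltW zb)) (nv z' az' zb') (st _ _ az zb zz')).
(* Depth [k.+1], because one unit is lost in a coinductive premiss. *)
have [c cl cP] := cv l ll al lb k.+1.
have [m [ml cm am]] := wmax2 cl al.
have kk : k <= k.+1 - coind r i by apply: subsub_gt => //; case: coind.
exists m => // z mz zl; have [E E'] := cP z (wle_trans cm mz) zl.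
have az := wle_trans am mz; have zb := wltW (wlt_le_trans zl lb).
have nz := nv z az zb; split.
  by apply: trunc_le kk _; exact: (trunc_node i nz (nv l (wltW al) lb) E).
move=> z' zz'; apply: stepge_le kk _.
have z'l := wsucc_le zz' zl; have az' := wle_trans az (wltW zz'.1).
exact: (node_stepge i nz (nv z' az' (wle_trans z'l lb)) (E' z' zz')).
Qed.

Lemma stutseq_red (W : wellorder) (x y : W) u : wle x y ->
  stutseq zero 0 x y u -> coinductive_red zero y (u x) (u y).
Proof.
elim: y / (wlt_wf y) x u => y _ IHy x0 u0 xy0 H0.
(* The end point [y] is fixed, while the start and the sequence vary: splitting moves the start and
   projection changes the sequence. *)
pose X s t := exists x u,
  [/\ wle x y, stutseq zero 0 x y u, s = u x & t = u y].
pose Y (j : @judgement S D) := match j with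
  | Red s t => X s t
  | Lifted s t => exists r (ss ts : 'I_(arity r) -> derivation D),
     [/\ node ss s, node ts t, concl s = concl t & forall i, X (ss i) (ts i)]
  end.
(* The induction hypothesis at [a] gives a split followed by a [Lifted], and all levels occurring
   there are below [y]. *)
have prefix x a u : wle x a -> wlt a y -> stutseq zero 0 x a u ->
    exists m s, presplit zero (lower_at zero y) m (u x) s
      /\ lower_at zero y s (u a).
  move=> xa ay H; have := IHy a ay x u xa H.
  rewrite /coinductive_red holdsE => /derivable_split[s [m [xs sa]]].
  exists m, s; split; last by exists a, ay; rewrite holdsE.
  apply: presplit_sub xs => s' t [z [za zP]].
  by exists z, (wlt_trans za ay).
(* From [a] on all steps have positive depth. At a limit [y], [a] comes from convergence at depth 1;
   otherwise [a] is [y] itself and no step is left. *)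
have pivot x u : wle x y -> stutseq zero 0 x y u ->
    exists a, [/\ wle x a, wle a y, stutseq zero 1 a y u &
      exists m, presplit zero (lower_at zero y) m (u x) (u a)].
  move=> xy H; have [st cv] := H.
  have yy : stutseq zero 1 y y u.
    split=> [z z' yz zy|l _ yl ly]; first by case: (wleNgt yz zy).
    by case: (wleNgt ly yl).
  case: xy H => [xy H|->]; last first.
    exists y; split=> //; try by right.
    by exists 0; apply: presplit0; exact: rt_refl.
  have [y0|[z zy]|yl] := wcases y; first by case: (y0 x).
    exists y; split=> //; [by left|by right|].
    have xz := wlt_succ zy xy.
    have [m [s [xs sz]]] := prefix x z u xz zy.1
      (stutseq_sub (wle_refl x) (wltW zy.1) H).
    by exists m.+1; apply: presplit_rcons xs sz _;
      apply: stepge_steps (st z y xz zy.1 zy).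
  have [c cy cP] := cv y yl xy (wle_refl y) 1.
  have [a [ay ca xa]] := wmax2 cy xy.
  exists a; split=> //; first by left.
    split=> [z z' az zy|l ll al ly]; last by apply: cv => //; exact: wle_lt_trans al.
    by apply: (cP z (wle_trans ca az) zy).2.
  have [m [s [xs sz]]] := prefix x a u xa ay (stutseq_sub (wle_refl x) (wltW ay) H).
  by exists m.+1; apply: presplit_rcons xs sz _; exact: rt_refl.
rewrite /coinductive_red holdsE; apply: (@coinduction _ _ Y); last first.
- by exists x0, u0.
- exact: red_rules_wf.
case=> s t /=; last first.
  move=> [r [ss [ts [ns nt st ssts]]]].
  exists (Lift _ _ r), (fun i => Red (ss i) (ts i)).
  by split=> //=; exists ss, ts, s, t.
move=> [x [u [xy H -> ->]]].
(* [Split] accounts for the sequence up to [a], and [Lift] for the rest, projected to the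
   premisses. *)
have [a [xa ay Ha xaP]] := pivot x u xy H.
exists (Split xaP), (fun=> Lifted (u a) (u y)); split; first by exists (u y).
move=> _; have [r [v [na ny] vP]] := stutseq_child ay Ha.
exists r, (v^~ a), (v^~ y); split=> //.
  exact: trunc_concl (stutseq_trunc zero_concl Ha ay (wle_refl y)).
move=> i; exists a, (v i); split=> //.
have [st cv] := vP i; split=> // z z' az zy zz'.
exact: stepge_le (st z z' az zy zz').
Qed.

End SequenceToRed.

(** * Metric and truncations; countability of the length *)

Section Forward.
Context (R : realType) {S : Type} {D : rules S}.
Variable zero : derivation D -> derivation D -> Prop.

Lemma dist_trunc (s t : derivation D) n :
  (dist R s t < (2%:R ^- n)%R%:E)%E -> trunc n s = trunc n t.
Proof.
move=> /ereal_inf_lt[_ [d st <-]]; rewrite lte_fin => dn.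
apply: trunc_le st; rewrite leqNgt; apply/negP => dn'; move: dn.
by rewrite ltf_pV2 ?posrE ?exprn_gt0 // ltr_eXn2l ?ltr1n // ltnNge (ltnW dn').
Qed.

Lemma trunc_dist (s t : derivation D) n :
  trunc n s = trunc n t -> (dist R s t <= (2%:R ^- n)%R%:E)%E.
Proof. by move=> st; apply: ereal_inf_lbound; exists n. Qed.

Lemma infinitary_stutseq (W : wellorder) (a g : W) u d : 
  rewriting_sequence zero g u d -> strongly_converging R g u d ->
  stutseq zero 0 a g u.
Proof.
move=> st cv; split=> [x x' _ xg xx'|l ll al lg n].
  by right; exists (d x) => //; exact: st.
have [dst dep] := cv l ll lg.
have [b bl bP] := dst (2%:R ^- n)%R ltac:(by rewrite invr_gt0 exprn_gt0).
have [c cl cP] := dep n; have [m [ml bm cm]] := wmax2 bl cl.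
exists m => // x mx xl; split.
  exact: dist_trunc (bP x (wle_trans bm mx) xl).
move=> x' xx'; right; exists (d x); first exact: cP (wle_trans cm mx) xl.
by apply: st xx'; exact: wlt_le_trans lg.
Qed.

(* The depths of the steps before a limit tend to infinity, hence every limit is
   the supremum of a sequence. *)
Lemma strongly_converging_countable (W : wellorder) (g : W) u d :
  strongly_converging (D := D) R g u d -> wcountable g.
Proof.
move=> cv; have := wle_refl g; elim: {1 3}g / (wlt_wf g) => y _ IH yg.
have {}IH z : wlt z y -> wcountable z.
  by move=> zy; apply: IH => //; left; exact: wlt_le_trans yg.
have [y0|[z zy]|yl] := wcases y.
- rewrite /wcountable (_ : [set z | _] = set0) //; apply/seteqP.
  by split=> // z /= /y0.
- have sub : [set x | wlt x y] `<=`
      \bigcup_(b in [set: bool]) (if b then [set x | wlt x z] else [set z]).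
    by move=> x /= /(wlt_succ zy)[xz|->]; [exists true|exists false].
  apply: sub_countable (subset_card_le sub) _.
  by apply: bigcup_countable => // -[] _; [exact: IH zy.1|exact: countable1].
have /choice[a aP] (n : nat) : exists a, wlt a y /\
    forall x, wle a x -> wlt x y -> n <= d x.
  by have [_ /(_ n)[a]] := cv y yl yg; exists a.
apply: (@sub_countable _ _ _ (\bigcup_n [set x | wlt x (a n)])); last first.
  by apply: bigcup_countable => // n _; exact: IH (aP n).1.
apply: subset_card_le => x /= xy; apply: contrapT => H.
(* A point past every [a n] would have a step deeper than its own depth. *)
suff : (d x).+1 <= d x by rewrite ltnn.
apply: (aP (d x).+1).2 => //; have [xa|//] := wltgeP x (a (d x).+1).
by case: H; exists (d x).+1.
Qed.

End Forward.

(** * Constructions of well-orders *)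

Section BoolOrder.

Definition bool_lt (x y : bool) : Prop := ~~ x && y.

Lemma bool_lt_wf : well_founded bool_lt.
Proof.
have Af : Acc bool_lt false by constructor=> x; rewrite /bool_lt andbF.
by case; [constructor=> -[//|/=]|exact: Af].
Qed.

Lemma bool_lt_trans x y z : bool_lt x y -> bool_lt y z -> bool_lt x z.
Proof. by case: x y z => [] [] []. Qed.

Lemma bool_lt_total x y : [\/ bool_lt x y, x = y | bool_lt y x].
Proof.
by case: x y => [] [];
  [constructor 2|constructor 3|constructor 1|constructor 2].
Qed.

Definition bool_wellorder : wellorder :=
  Wellorder bool_lt_wf bool_lt_trans bool_lt_total.

End BoolOrder.

(** * Restriction of a well-order to a subset *)

Section SubOrder.
Variables (W : wellorder) (Q : W -> Prop).

Definition sub_lt (x y : {x | Q x}) : Prop := wlt (sval x) (sval y).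

Lemma sub_lt_wf : well_founded sub_lt.
Proof. exact: (wf_inverse_image {x | Q x} _ _ sval (@wlt_wf W)). Qed.

Lemma sub_lt_trans x y z : sub_lt x y -> sub_lt y z -> sub_lt x z.
Proof. exact: wlt_trans. Qed.

Lemma sub_lt_total x y : [\/ sub_lt x y, x = y | sub_lt y x].
Proof.
case: x y => [x Qx] [y Qy]; have [xy|xy|yx] := wlt_total x y.
- by constructor 1.
- by constructor 2; apply: eq_exist.
- by constructor 3.
Qed.

Definition sub_wellorder : wellorder :=
  Wellorder sub_lt_wf sub_lt_trans sub_lt_total.

Lemma sub_wleE (x y : sub_wellorder) : wle x y <-> wle (sval x) (sval y).
Proof.
split=> [[xy|->]|xy]; [by left|by right|].
by have [/(wleNgt xy)|//] := wltgeP y x.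
Qed.

End SubOrder.

(** * Sum of a sequence of well-orders, with a top element *)

Section OmegaSum.
Variable Wk : nat -> wellorder.

(** [None] is the top, where the limit of a concatenation will be placed. *)
Definition sum_carrier := option {k & Wk k}.

Definition pt k (x : Wk k) : sum_carrier := Some (Tagged (fun k => Wk k) x).

Lemma pt_inj k (x y : Wk k) : pt x = pt y -> x = y.
Proof. by move=> /Some_inj e; exact: eq_from_Tagged e. Qed.

(** Within one component, the two points are given through equations between tagged pairs, which
    avoids transport along an equality of tags. *)
Definition sum_lt (p q : sum_carrier) : Prop :=
  match p, q with
  | Some p, Some q => tag p < tag q \/
      exists k (x y : Wk k), [/\ p = Tagged (fun k => Wk k) x,
        q = Tagged (fun k => Wk k) y & wlt x y]
  | Some _, None => True
  | None, _ => False
  end.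

Lemma sum_ltE k (x y : Wk k) : sum_lt (pt x) (pt y) <-> wlt x y.
Proof.
split=> [[|[k' [x' [y' [ex ey]]]]]|xy]; first by rewrite /= ltnn.
  have ek := congr1 tag ex; rewrite /= in ek; subst k'.
  by rewrite (eq_from_Tagged ex) (eq_from_Tagged ey).
by right; exists k, x, y.
Qed.

Lemma sum_lt_tag k k' (x : Wk k) (y : Wk k') : sum_lt (pt x) (pt y) -> k <= k'.
Proof.
by move=> [/ltnW//|[j [x' [y' [/(congr1 tag)/= -> /(congr1 tag)/= ->]]]]].
Qed.

Lemma sum_lt_wf : well_founded sum_lt.
Proof.
have H p : Acc sum_lt (Some p).
  case: p => k; elim/ltn_ind: k => k IHk x.
  elim: x / (wlt_wf x) => x _ IHx; constructor=> -[[j y]|//] yx.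
  have := sum_lt_tag yx; rewrite leq_eqVlt => /orP[/eqP jk|jk]; last exact: IHk.
  by subst j; apply: IHx; apply/sum_ltE.
by case=> [p|]; [exact: H|constructor=> -[p _|//]; exact: H].
Qed.

Lemma sum_lt_trans p q r : sum_lt p q -> sum_lt q r -> sum_lt p r.
Proof.
case: p q r => [[i x]|//] [[j y]|//] [[k z]|//] xy yz.
have ij := sum_lt_tag xy; have jk := sum_lt_tag yz.
move: (ij); rewrite leq_eqVlt => /orP[/eqP ij'|ij']; last first.
  by left; exact: leq_trans jk.
move: (jk); rewrite leq_eqVlt => /orP[/eqP jk'|jk']; last first.
  by left; exact: leq_ltn_trans jk'.
subst j k; apply/sum_ltE; move/sum_ltE : xy => xy; move/sum_ltE : yz.
exact: wlt_trans.
Qed.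

Lemma sum_lt_total p q : [\/ sum_lt p q, p = q | sum_lt q p].
Proof.
case: p q => [[i x]|] [[j y]|];
  [|by constructor 1|by constructor 3|by constructor 2].
have [ij|ji|ij] := ltngtP i j; [by constructor 1; left|by constructor 3; left|].
subst j; have [xy|->|yx] := wlt_total x y; [|by constructor 2|].
  by constructor 1; apply/sum_ltE.
by constructor 3; apply/sum_ltE.
Qed.

Definition sum_wellorder : wellorder :=
  Wellorder sum_lt_wf sum_lt_trans sum_lt_total.

Implicit Types p q : sum_wellorder.

Lemma sum_leE k (x y : Wk k) : @wle sum_wellorder (pt x) (pt y) <-> wle x y.
Proof.
split=> [[/sum_ltE|/pt_inj->]|[/sum_ltE|->]]; by [left|right].
Qed.

Lemma sum_le_tag k k' (x : Wk k) (y : Wk k') :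
  @wle sum_wellorder (pt x) (pt y) -> k <= k'.
Proof. by move=> [/sum_lt_tag//|/Some_inj/(congr1 tag)/= ->]. Qed.

Lemma sum_between k (x z : Wk k) p : @wle sum_wellorder (pt x) p ->
  @wlt sum_wellorder p (pt z) ->
  exists y, [/\ p = pt y, wle x y & wlt y z].
Proof.
case: p => [[j y]|//] xy yz.
have jk : j = k by apply/eqP; rewrite eqn_leq (sum_lt_tag yz) (sum_le_tag xy).
by subst j; exists y; split=> //; [exact/sum_leE|exact/sum_ltE].
Qed.

Lemma sum_before_zero k (x : Wk k) (z : Wk k.+1) p : wzero z ->
  @wle sum_wellorder (pt x) p -> @wlt sum_wellorder p (pt z) ->
  exists2 y, p = pt y & wle x y.
Proof.
move=> z0; case: p => [[j y]|//] xy yz.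
have := sum_lt_tag yz; rewrite leq_eqVlt => /orP[/eqP jk|jk].
  by subst j; case: (z0 y); apply/sum_ltE.
have {}jk : j = k by apply/eqP; rewrite eqn_leq -ltnS jk (sum_le_tag xy).
by subst j; exists y => //; exact/sum_leE.
Qed.

Hypothesis inhabited : forall k, exists x : Wk k, True.

(** As no component is empty, a successor can neither skip a component nor be the top; it may only
    cross from a maximum to the next zero. *)
Lemma sum_succ p q : wsucc p q -> exists k (x : Wk k), p = pt x /\
  ((exists2 x', q = pt x' & wsucc x x') \/
   (exists x' : Wk k.+1, [/\ q = pt x', wzero x' & forall y, wle y x])).
Proof.
case: p => [[k x]|]; last by case; case: q.
case: q => [[k' x']|] [xq nb]; exists k, x; split=> //; last first.
  by have [y _] := inhabited k.+1; case: (nb (pt y)); split=> //; left.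
have := sum_lt_tag xq; rewrite leq_eqVlt => /orP[/eqP kk|kk].
  subst k'; left; exists x' => //; split; first exact/sum_ltE.
  by move=> z [xz zx]; apply: (nb (pt z)); split; apply/sum_ltE.
have {}kk : k' = k.+1.
  apply/eqP; rewrite eqn_leq kk andbT leqNgt; apply/negP => kk'.
  by have [y _] := inhabited k.+1; apply: (nb (pt y)); split; left.
subst k'; right; exists x'; split=> // y.
  by move=> yx; apply: (nb (pt y)); split; [left|exact/sum_ltE].
have [xy|//] := wltgeP x y.
by case: (nb (pt y)); split; [exact/sum_ltE|left].
Qed.

(** Besides the top, the only limits not inherited from a component are zeros of later components,
    whose predecessor component may lack a maximum. *)
Lemma sum_limit q : wlimit q -> q = None \/
  exists k (x : Wk k), q = pt x /\ (wlimit x \/ (wzero x /\ 0 < k)).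
Proof.
case: q => [[k x]|] ql; [right|by left]; exists k, x; split=> //.
have [x0|[z zx]|xl] := wcases x; last by left.
  right; split=> //; case: k x x0 ql => // x x0 [] []; case=> [[j y]|//] yx.
  have := sum_lt_tag yx; rewrite leqn0 => /eqP j0; subst j.
  by apply: (x0 y); apply/sum_ltE.
case: (ql.2 (pt z)); split; first by apply/sum_ltE; exact: zx.1.
move=> p [zp px]; have [y [py [zy|zy] yx]] := sum_between (wltW zp) px.
  exact: zx.2 (conj zy yx).
by subst p y; exact: wlt_irr zp.
Qed.

End OmegaSum.

(** * Closure properties of strongly converging sequences *)

Section Reach.
Context {S : Type} {D : rules S}.
Variable zero : derivation D -> derivation D -> Prop.
Hypothesis zero_concl : preserves_concl zero.
Implicit Types s t : derivation D.

(* The sequence is continued by a constant one after [b], so that the remaining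
   conditions need not be restricted to an interval. *)
Definition reaching n s t (W : wellorder) (a b : W) (u : W -> derivation D) :=
  [/\ wzero a, u a = s, forall x, wle b x -> u x = t,
      forall x x', wsucc x x' -> stepge zero n (u x) (u x')
    & forall l, wlimit l -> conv zero u l].

Definition reach n s t := exists (W : wellorder) (a b : W) u, reaching n s t a b u.

Lemma reaching_stutseq n s t (W : wellorder) (a b x y : W) u :
  reaching n s t a b u -> stutseq zero n x y u.
Proof.
by case=> _ _ _ st cv; split=> [z z' _ _|l ll _ _]; [exact: st|exact: cv].
Qed.

Lemma reaching_trunc n s t (W : wellorder) (a b : W) u x :
  reaching n s t a b u -> trunc n (u x) = trunc n s.
Proof.
move=> H; case: (H) => a0 <- _ _ _; symmetry.
apply: (stutseq_trunc zero_concl (reaching_stutseq a x H) _ (wle_refl x)).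
exact: wzero_le.
Qed.

Lemma reach_trunc n s t : reach n s t -> trunc n s = trunc n t.
Proof.
move=> [W [a [b [u H]]]]; rewrite -(reaching_trunc b H); case: H => _ _ -> //.
exact: wle_refl.
Qed.

Lemma reach_concl n s t : reach n s t -> concl s = concl t.
Proof. by move/reach_trunc/trunc_concl. Qed.

Lemma reach_le m n s t : m <= n -> reach n s t -> reach m s t.
Proof.
move=> mn [W [a [b [u [a0 ua ub st cv]]]]]; exists W, a, b, u; split=> // x x' xx'.
exact: stepge_le mn (st x x' xx').
Qed.

Lemma reach_stepge n s t : stepge zero n s t -> reach n s t.
Proof.
move=> st; exists bool_wellorder, false, true, (fun x : bool => if x then t else s).
split=> //.
- by case.
- by case=> // -[].
- by case=> -[] // [].
- by case=> -[nz ns]; [case: (ns false); split=> // -[] []|case: nz; case].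
Qed.

(** Concatenation of the given sequences along the omega-sum, with [t] at the top. At the top, the
    depths [nn k] control the variation inside each component, and the [v k] approach [t]. *)
Lemma reach_lim n (nn : nat -> nat) (v : nat -> derivation D) t :
  (forall k, n <= nn k) -> (forall k, reach (nn k) (v k) (v k.+1)) ->
  (forall m, exists K, forall k, K <= k -> m <= nn k /\ trunc m (v k) = trunc m t) ->
  reach n (v 0) t.
Proof.
move=> nle /(_ _)/cid-/all_sig[Wk]; move=> /(_ _)/cid-/all_sig[a].
move=> /(_ _)/cid-/all_sig[b] /(_ _)/cid-/all_sig[u] H lim.
have inh k : exists x : Wk k, True by exists (a k).
have az k : wzero (a k) by case: (H k).
have ua k : u k (a k) = v k by case: (H k).
have ub k x : wle (b k) x -> u k x = v k.+1 by case: (H k) => _ _ + _ _; exact.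
pose U (p : sum_wellorder Wk) := if p is Some p then u (tag p) (tagged p) else t.
have zeroU k (x : Wk k) : wzero x -> U (pt x) = v k.
  by move=> x0; rewrite -ua /U /=; congr u; apply: wle_anti; exact: wzero_le.
have stU k (x : Wk k) q : @wsucc (sum_wellorder Wk) (pt x) q ->
    stepge zero (nn k) (U (pt x)) (U q).
  move=> /(sum_succ inh)[k' [x1 [ex xq]]].
  have ek := congr1 (fun p => if p is Some p then tag p else 0) ex.
  rewrite /= in ek; subst k'; have {}ex := pt_inj ex; subst x1.
  case: xq => [[x' -> xx']|[x' [-> x'0 xmax]]].
    by case: (H k) => _ _ _ + _; exact.
  (* Crossing to the next component is a trivial step: a maximum lies past [b k], where the value is
     already [v k.+1]. *)
  by left; rewrite (zeroU _ _ x'0) /U /= ub.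
exists (sum_wellorder Wk), (pt (a 0)), None, U; split.
- case=> [[k x]|//] xa; have := sum_lt_tag xa; rewrite leqn0 => /eqP k0; subst k.
  by apply: (az 0 x); apply/sum_ltE.
- by rewrite zeroU.
- by case=> [p []|].
- move=> p q pq; have [k [x [ep _]]] := sum_succ inh pq.
  by subst p; apply: stepge_le (nle k) (stU _ _ _ pq).
move=> q ql m; case: (sum_limit ql) => [->|[k [x [ex [xl|[x0 k0]]]]]].
- have [K KP] := lim m; exists (pt (a K)) => // -[[k y]|[]//] ay _.
  have Kk := sum_le_tag ay; have [mk vt] := KP k Kk; split.
    by rewrite /= -vt; apply: trunc_le mk (reaching_trunc _ (H k)).
  by move=> x' yx'; exact: stepge_le mk (stU _ _ _ yx').
- have [_ _ _ _ /(_ x xl m)[c cx cP]] := H k; subst q.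
  exists (pt c); first exact/sum_ltE.
  move=> p cp px; have [y [ep cy yx]] := sum_between cp px; subst p.
  have [yE yS] := cP y cy yx; split=> // p' pp'.
  have p'x := wsucc_limit ql pp' px.
  have cp' := wle_trans cp (wltW pp'.1).
  have [y' [ep' cy' yx']] := sum_between cp' p'x; subst p'.
  apply: (yS y'); split; first by apply/sum_ltE; exact: pp'.1.
  by move=> z [yz zy]; apply: (pp'.2 (pt z)); split; apply/sum_ltE.
case: k x ex x0 k0 => // k x ex x0 _; subst q.
(* If the zero of component [k.+1] is a limit, the sequence is constant from [b k] up to it. *)
have const p : @wle (sum_wellorder Wk) (pt (b k)) p ->
    @wlt (sum_wellorder Wk) p (pt x) -> U p = U (pt x).
  move=> bp px; have [y -> /ub] := sum_before_zero x0 bp px.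
  by rewrite (zeroU _ _ x0).
exists (pt (b k)); first by left.
move=> p bp px; split; first by rewrite const.
move=> p' pp'; left; rewrite !const //.
  exact: wle_trans (wltW pp'.1).
exact: wsucc_limit px.
Qed.

Lemma reach_trans n s s' t : reach n s s' -> reach n s' t -> reach n s t.
Proof.
(* The two sequences are followed by trivial ones at [t]; these can be given depths [n + k], which
   tend to infinity. *)
move=> ss' s't; pose v k := if k is k'.+1 then if k' is _.+1 then t else s' else s.
apply: (@reach_lim n (fun k => if k < 2 then n else n + k) v).
- by move=> k; case: ifP => // _; rewrite leq_addr.
- by case=> [|[|k]] //=; apply: reach_stepge; left.
move=> m; exists m.+2 => -[|[|k]] //= mk; split=> //.
by rewrite (leq_trans _ (leq_addl _ _)) // (leq_trans _ mk) // -addn2 leq_addr.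
Qed.

Lemma reach_steps s t : steps zero s t -> reach 0 s t.
Proof.
elim=> {s t} [s t [k st]|s|s s' t _ ss' _ s't].
- by apply: reach_stepge; right; exists k.
- by apply: reach_stepge; left.
- exact: reach_trans s't.
Qed.

Lemma reach_node1 n r (i : 'I_(arity r)) (ss ts : 'I_(arity r) -> derivation D) s t :
  node ss s -> node ts t -> (forall j, j != i -> ts j = ss j) ->
  reach (n - coind r i) (ss i) (ts i) -> reach n s t.
Proof.
move=> ns nt E [W [a [b [u H]]]].
pose w x j := if j == i then u x else ss j.
(* The [i]-th premiss keeps its conclusion along the sequence, so the rule still applies at each of
   its points. *)
have /choice[v vP] x : exists v, node (w x) v /\ concl v = concl s.
  have [|v nv vs] := @node_replace _ _ _ _ (w x) _ ns; last by exists v.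
  move=> j; rewrite /w; case: eqP => // ->.
  exact: trunc_concl (reaching_trunc x H).
have wi x : w x i = u x by rewrite /w eqxx.
have wj x y j : j != i -> w y j = w x j by rewrite /w => /negPf ->.
have [a0 ua ub st cv] := H.
exists W, a, b, v; split=> //.
- suff ws : w a = ss by have [+ _] := vP a;
    rewrite ws => nva; exact: node_functional nva ns.
  by apply: funext => j; rewrite /w; case: eqP => // ->.
- move=> x bx; have [+ _] := vP x.
  suff -> : w x = ts by move=> nva; exact: node_functional nva nt.
  by apply: funext => j; rewrite /w; case: eqVneq => [->|/E//]; exact: ub.
- move=> x x' xx'; have [nx _] := vP x; have [nx' _] := vP x'.
  by apply: (stepge_node (i := i) nx nx' (wj _ _)); rewrite !wi; exact: st.
(* Depth [m.+1] is used since [node_trunc] concerns positive depths only. *)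
move=> l ll m; have [c cl cP] := cv l ll m.+1; exists c => // x cx xl.
have [nx cx'] := vP x; have [nl cl'] := vP l.
have [Ex Sx] := cP x cx xl; split.
  apply: (@trunc_le _ _ _ _ m.+1) => //; apply: node_trunc nx nl _ _ => [|j].
    by rewrite cx' cl'.
  have [->|ji] := eqVneq j i; last by rewrite (wj x l).
  by rewrite !wi; apply: trunc_le Ex; exact: leq_subr.
move=> x' xx'; have [nx' _] := vP x'.
apply: (stepge_node (i := i) nx nx' (wj _ _)); rewrite !wi.
by apply: stepge_le (Sx x' xx');
  rewrite leq_subLR (leq_trans (leqnSn m)) // leq_addl.
Qed.

(** The finitely many premisses are rewritten one after another; in [w k] the first [k] of them are
    done. *)
Lemma reach_node n r (ss ts : 'I_(arity r) -> derivation D) s :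
  node ss s -> (forall i, reach (n - coind r i) (ss i) (ts i)) ->
  exists2 t, node ts t & reach n s t.
Proof.
move=> ns ssts; pose w k (j : 'I_(arity r)) := if j < k then ts j else ss j.
suff H k : k <= arity r -> exists2 t, node (w k) t & reach n s t.
  have [t nt st] := H (arity r) (leqnn _); exists t => //.
  by suff <- : w (arity r) = ts by []; apply: funext => j; rewrite /w ltn_ord.
elim: k => [_|k IH kr].
  by exists s; [exact: ns|apply: reach_stepge; left].
have [t nt st] := IH (ltnW kr); pose i := Ordinal kr.
have [|t' nt' _] := @node_replace _ _ _ _ (w k.+1) _ nt.
  move=> j; rewrite /w ltnS; case: ltngtP => // jk; symmetry.
  exact: reach_concl (ssts j).
exists t' => //; apply: reach_trans st _; apply: (reach_node1 (i := i) nt nt').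
  move=> j ji; rewrite /w ltnS leq_eqVlt; case: eqP => //= jk.
  by case/eqP: ji; exact: val_inj.
by rewrite /w /= ltnn ltnSn; exact: ssts.
Qed.

End Reach.

(** * Removing stuttering *)

Section Destutter.
Context (R : realType) {S : Type} {D : rules S}.
Variable zero : derivation D -> derivation D -> Prop.
Hypothesis zero_concl : preserves_concl zero.
Implicit Types s t : derivation D.

Lemma small_exp (e : R) : (0 < e)%R -> exists n, (2%:R ^- n < e)%R.
Proof.
move=> e0; have [n en] : exists n : nat, (e^-1 < n%:R)%R.
  by exists (Num.truncn e^-1).+1; exact: truncnS_gt.
exists n; rewrite invf_plt ?posrE ?exprn_gt0 //.
by apply: lt_trans en _; rewrite -natrX ltr_nat ltn_expl.
Qed.

(** Distinct trees differ in some truncation, which bounds the depths of the steps between them.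
    Taking the largest depth gives one annotation that satisfies every lower bound met by any such
    step. *)
Lemma max_depth s t : s <> t -> exists d, forall k, step zero k s t ->
  step zero d s t /\ k <= d.
Proof.
move=> st; have [[k0 sk0]|no] := pselect (exists k, step zero k s t); last first.
  by exists 0 => k sk; case: no; exists k.
have [N nN] : exists N, trunc N s <> trunc N t.
  apply: contrapT => /forallNP H.
  by apply: st; apply: trunc_eq => d; exact: contrapT (H d).
have ex : exists k, `[< step zero k s t >] by exists k0; exact/asboolP.
have ub k : `[< step zero k s t >] -> k <= N.
  move=> /asboolP/(step_trunc zero_concl) E; rewrite leqNgt; apply/negP => Nk.
  by apply: nN; exact: trunc_le (ltnW Nk) E.
have [d /asboolP sd dmax] := ex_maxnP ex ub.
by exists d => k sk; split=> //; apply: dmax; exact/asboolP.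
Qed.

(** The sequence is restricted to the points where it moves, together with its end [b]. *)
Lemma reach_infinitary s t : reach zero 0 s t -> infinitary R zero s t.
Proof.
move=> [W [a [b [u [a0 ua ub st cv]]]]].
pose moves x := exists2 x', wsucc x x' & u x <> u x'.
(* Without moves all steps are trivial, hence deeper than any [n], so that the endpoints agree in
   all truncations. *)
have const x y : wle x y -> (forall z, wle x z -> wlt z y -> ~ moves z) -> u x = u y.
  move=> xy nm; apply: (stutseq_const zero_concl _ xy) => n.
  split=> [z z' xz zy zz'|].
    by left; apply: contrapT => zN; apply: (nm z xz zy); exists z'.
  by move=> l ll _ _; exact: cv.
have movesb x : moves x -> wlt x b.
  move=> [x' xx' N]; have [//|bx] := wltgeP x b; case: N.
  by rewrite !ub //; exact: wle_trans (wltW xx'.1).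
pose Q x := moves x \/ x = b; pose W' := @sub_wellorder W Q.
have leb (x : W') : wle (sval x) b.
  by case: x => x /= [/movesb|->]; [left|right].
pose g : W' := exist _ b (or_intror erefl); pose u' (x : W') := u (sval x).
have movesW (x : W') : wlt x g -> moves (sval x).
  by rewrite /wlt /= /sub_lt /=; case: x => x /= [//|->] /wlt_irr.
have below (x : W) (y : W') : moves x -> wlt x (sval y) ->
    exists2 x' : W', sval x' = x & wlt x' y.
  by move=> mx xy; exists (exist _ x (or_introl mx)).
have /choice[d dP] (x : W') : exists d, forall x', wsucc (sval x) x' ->
    u (sval x) <> u x' -> forall k, step zero k (u (sval x)) (u x') ->
    step zero d (u (sval x)) (u x') /\ k <= d.
  have [[x' xx']|no] := pselect (exists x', wsucc (sval x) x'); last first.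
    by exists 0 => x' xx'; case: no; exists x'.
  have [ne|e] := pselect (u (sval x) <> u x'); last first.
    exists 0 => x'' xx''; suff -> : x'' = x' by [].
    by apply: wle_anti; [exact: wsucc_le xx'' xx'.1|exact: wsucc_le xx' xx''.1].
  have [d dP] := max_depth ne; exists d => x'' xx''; suff -> : x'' = x' by [].
  by apply: wle_anti; [exact: wsucc_le xx'' xx'.1|exact: wsucc_le xx' xx''.1].
exists W', g, u', d; split.
- move=> x x0; rewrite /u' -ua; symmetry; apply: const; first exact: wzero_le.
  by move=> z _ zx mz; have [z' _] := below z x mz zx; exact: x0.
- by rewrite /u' /= ub //; right.
- move=> x y xg xy; have [x1 xx1 ne] := movesW x xg.
  have x1y : wle x1 (sval y) by exact: wsucc_le xx1 xy.1.
  (* The successor [y] in [W'] may lie beyond the successor [x1] in [W], but there is no move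
     between them. *)
  have -> : u' y = u x1.
    symmetry; apply: const x1y _ => z x1z zy mz.
    have [z' ez zy'] := below z y mz zy; apply: (xy.2 z'); split=> //.
    by rewrite /= /sub_lt ez; exact: wlt_le_trans xx1.1 x1z.
  have [//|[k _ sk]] := st _ _ xx1.
  by have [] := dP x x1 xx1 ne k sk.
move=> l ll lg.
(* the supremum in W of the points of W' below l *)
have [l0 l0P l0min] : exists2 l0 : W, forall x : W', wlt x l -> wlt (sval x) l0
    & forall y, (forall x : W', wlt x l -> wlt (sval x) y) -> wle l0 y.
  by apply: wmin; exists (sval l).
have l0l : wle l0 (sval l) by exact: l0min.
have cof y : wlt y l0 -> exists2 x : W', wle y (sval x) & wlt x l.
  move=> yl0; apply: contrapT => no; apply: (wleNgt _ yl0); apply: l0min => x xl.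
  by have [//|yx] := wltgeP (sval x) y; case: no; exists x.
have l0lim : wlimit l0.
  split=> [z|y yl0].
    have [x xl] : exists x, wlt x l.
      by apply: contrapT => /forallNP; exact: ll.1.
    exact: z (l0P x xl).
  have [x yx xl] := cof y yl0.1.
  have xy : sval x = y by apply: wle_anti => //; exact: wlt_succ yl0 (l0P x xl).
  apply: (ll.2 x); split=> // z [xz zl].
  by apply: (yl0.2 (sval z)); split; [rewrite -xy|exact: l0P].
(* A move between [l0] and [l] would be a point of [W'] below [l], hence below [l0]. *)
have ul : u l0 = u' l.
  apply: const l0l _ => z l0z zl mz; have [z' ez zl'] := below z l mz zl.
  by apply: (wleNgt l0z); rewrite -ez; exact: l0P.
have near n : exists2 c : W', wlt c l & forall x : W', wle c x -> wlt x l ->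
    trunc n (u' x) = trunc n (u' l) /\ n <= d x.
  have [c cl0 cP] := cv l0 l0lim n; have [c' cc' c'l] := cof c cl0.
  exists c' => // x cx xl; have [xl0 xg] := (l0P x xl, wlt_le_trans xl lg).
  have [E H] := cP _ (wle_trans cc' (iffLR (sub_wleE c' x) cx)) xl0.
  rewrite -ul; split=> //; have [x1 xx1 ne] := movesW x xg.
  have [//|[k nk sk]] := H x1 xx1; apply: leq_trans nk _.
  by have [] := dP x x1 xx1 ne k sk.
split=> [e e0|n]; last first.
  by have [c cl cP] := near n; exists c => // x cx xl; have [] := cP x cx xl.
have [n ne] := small_exp e0; have [c cl cP] := near n; exists c => // x cx xl.
have [E _] := cP x cx xl; apply: le_lt_trans (trunc_dist R E) _.
by rewrite lte_fin.
Qed.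

End Destutter.

(** * From coinductive derivations to strongly converging sequences *)

Section RedToSequence.
Context {S : Type} {D : rules S}.
Variable zero : derivation D -> derivation D -> Prop.
Hypothesis zero_concl : preserves_concl zero.
Variable lower : derivation D -> derivation D -> Prop.
Hypothesis lower_reach : forall s t, lower s t -> reach zero 0 s t.
Implicit Types s t : derivation D.

Lemma presplit_reach m s t : presplit zero lower m s t -> reach zero 0 s t.
Proof.
elim=> {m s t} [s t /(reach_steps zero_concl)//|m s s1 t1 t ss1 s1t1 _ t1t].
apply: reach_trans t1t => //; apply: reach_trans (lower_reach s1t1) => //.
exact: reach_steps.
Qed.

(** A derivation of [Red] unfolded to depth [n]: the trees share their rules down to that depth, and
    [Red] is derivable between the subtrees found there. *)
Inductive red_below : nat -> derivation D -> derivation D -> Prop :=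
| red_below0 s t : derivable zero lower (Red s t) -> red_below 0 s t
| red_belowS n r (ss ts : 'I_(arity r) -> derivation D) s t :
    node ss s -> node ts t -> concl s = concl t ->
    (forall i, red_below (n.+1 - coind r i) (ss i) (ts i)) ->
    red_below n.+1 s t.

(** Guarded induction on [T] performs the splits met before the first coinductive premisses; below
    those nothing is rewritten. *)
Lemma derivation_reach1 (T : derivation (red_rules zero lower)) s t :
  concl T = Some (Red s t) \/ concl T = Some (Lifted s t) ->
  exists2 s', reach zero 0 s s' & red_below 1 s' t.
Proof.
elim/(@derivation_guarded_ind _ (red_rules zero lower)): T s t.
case=> [s1 s2 [m H]|r] TT T nT IH s t.
  case=> TE; have [y /= [t' [y0 e]] yi] := derivable_child nT TE; last by [].
  case: e => es et; subst s1 t'.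
  have [s' s2s' s't] := IH ord0 isT s2 t
    (or_intror (etrans (yi ord0) (congr1 Some y0))).
  by exists s' => //; apply: reach_trans s2s' => //; exact: presplit_reach H.
case=> TE; have [y /= [ss [ts [s0 [t0 [yE ns nt st e]]]]] yi] :=
  derivable_child nT TE; first by [].
case: e => es et; subst s0 t0.
have /choice[ss' ssP] i : exists s', reach zero (0 - coind r i) (ss i) s'
    /\ red_below (1 - coind r i) s' (ts i).
  have [ci|ci] := boolP (coind r i).
    exists (ss i); split; first by apply: reach_stepge; left.
    by apply: red_below0; exists (TT i); rewrite yi yE.
  have [s' ss' s't] := IH i ci (ss i) (ts i)
    (or_introl (etrans (yi i) (congr1 Some (yE i)))).
  by exists s'.
have [s' ns' rs'] := reach_node zero_concl ns (fun i => (ssP i).1).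
exists s' => //; apply: red_belowS ns' nt _ (fun i => (ssP i).2).
by rewrite -(reach_concl zero_concl rs').
Qed.

(** At depth 0 no equality of conclusions is recorded; unfolding to depth 1 exhibits one, and the
    rewriting it takes preserves conclusions. *)
Lemma red_below_concl n s t : red_below n s t -> concl s = concl t.
Proof.
case=> [{}s {}t [T TE]|//].
have [s' ss' s't] := derivation_reach1 (or_introl TE).
rewrite (reach_concl zero_concl ss').
have pos m s1 t1 : red_below m s1 t1 -> 0 < m -> concl s1 = concl t1 by case.
exact: pos s't isT.
Qed.

Lemma red_below_trunc n s t : red_below n s t -> trunc n s = trunc n t.
Proof.
elim=> {n s t} [s t /red_below0/red_below_concl|n r ss ts s t ns nt st _ IH].
  exact: trunc0_concl.
exact: node_trunc ns nt st IH.
Qed.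

(** Every leaf of the unfolding is unfolded once more; it lies below [n] coinductive premisses, so
    the steps performed there have depth at least [n]. *)
Lemma red_below_reach n s t : red_below n s t ->
  exists s', reach zero n s s' /\ red_below n.+1 s' t.
Proof.
elim=> {n s t} [s t [T TE]|n r ss ts s t ns nt st _ IH].
  by have [s' ss' s't] := derivation_reach1 (or_introl TE); exists s'.
have [ss' ssP] := choice IH.
have [s' ns' rs'] := reach_node zero_concl ns (fun i => (ssP i).1).
exists s'; split=> //; apply: red_belowS ns' nt _ _.
  by rewrite -(reach_concl zero_concl rs').
by move=> i; have [_] := ssP i; rewrite (@subSn _ n.+1) //; case: coind.
Qed.

Lemma red_below_sequence n s t : red_below n s t -> reach zero n s t.
Proof.
move=> st.
have /choice[f fP] (p : nat * derivation D) : exists s', red_below p.1 p.2 t ->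
    reach zero p.1 p.2 s' /\ red_below p.1.+1 s' t.
  have [/red_below_reach[s' ?]|no] := pselect (red_below p.1 p.2 t).
    by exists s'.
  by exists s.
(* [v k] is what has been reached when the unfolding has depth [n + k]; its truncation at that depth
   is already the one of [t]. *)
pose v := fix v k := if k is k'.+1 then f (n + k', v k') else s.
have vP k : red_below (n + k) (v k) t.
  elim: k => [|k IH]; first by rewrite addn0.
  by rewrite addnS; exact: (fP (n + k, v k) IH).2.
apply: (reach_lim zero_concl (nn := addn n) (v := v)).
- by move=> k; exact: leq_addr.
- by move=> k; exact: (fP (n + k, v k) (vP k)).1.
move=> m; exists m => k mk.
have mnk : m <= n + k by rewrite (leq_trans mk) ?leq_addl.
by split=> //; apply: trunc_le mnk _; exact: red_below_trunc.
Qed.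

Lemma derivable_reach s t :
  derivable zero lower (Red s t) \/ derivable zero lower (Lifted s t) ->
  reach zero 0 s t.
Proof.
move=> st; have [T TE] : exists T : derivation (red_rules zero lower),
    concl T = Some (Red s t) \/ concl T = Some (Lifted s t).
  by case: st => -[T TE]; exists T; [left|right].
have [s' ss' /red_below_sequence s't] := derivation_reach1 TE.
by apply: reach_trans ss' _ => //; exact: reach_le s't.
Qed.

End RedToSequence.

Theorem theorem2p19 (R : realType) (S : Type) (D : rules S)
    (zero : derivation D -> derivation D -> Prop)
    (zero_concl : preserves_concl zero) (s t : derivation D) :
  infinitary R zero s t <->
  exists (W : wellorder) (g : W), wcountable g /\ coinductive_red zero g s t.
Proof.
split=> [[W [g [u [d [us ut st cv]]]]]|[W [g [_ st]]]].
  (* The level is the length of the sequence. *)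
  exists W, g; split; first exact: strongly_converging_countable cv.
  have [a a0] := wzero_ex g; rewrite -(us a a0) -ut.
  apply: stutseq_red => //; first exact: wzero_le.
  exact: infinitary_stutseq st cv.
apply: reach_infinitary => //.
(* Both judgements are treated together, since the lower levels enter through [Lifted] while the
   claim concerns [Red]. *)
suff H (x : W) s1 t1 : holds zero x (Red s1 t1) \/ holds zero x (Lifted s1 t1) ->
    reach zero 0 s1 t1 by apply: (H g); left.
elim: x / (wlt_wf x) s1 t1 => x _ IH s1 t1; rewrite !holdsE.
by apply: derivable_reach => // s2 t2 [y [yx yP]]; apply: (IH y yx); right.
Qed.
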